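(* Let $n,k,t,r$ be positive integers with $t\le k$. Let $\mathcal{R}$ be a set of $k$-subsets of $\mathbb{Z}_n$ such that each $t$-subset of $\mathbb{Z}_n$ is contained in at most one element of $\mathcal{R}$. Let $\mathcal{T}_1,\ldots,\mathcal{T}_r$ be pairwise disjoint Steiner systems $\mathrm{S}(t-1,k-1,n)$ on $\mathbb{Z}_n$ such that each $t$-subset of $\mathbb{Z}_n$ which is not contained in an element of $\mathcal{R}$ is contained in a block of exactly one of the $\mathcal{T}_i$'s, while a $t$-subset contained in an element of $\mathcal{R}$ is contained in no block of any $\mathcal{T}_i$. Let $\mathcal{C}$ be the set of words over $\mathbb{Z}_2^n\times\mathbb{Z}_{r+1}$ consisting of: (1) for each $\{x_1,\ldots,x_k\}\in\mathcal{R}$, the word with ones exactly in the binary coordinates $x_1,\ldots,x_k$ and $0$ in the last coordinate; and (2) for each $1\le i\le r$ and each $\{x_1,\ldots,x_{k-1}\}\in\mathcal{T}_i$, the word with ones exactly in the binary coordinates $x_1,\ldots,x_{k-1}$ (among the first $n$ coordinates) and the letter $i$ in the last coordinate. Then $\mathcal{C}$ is a mixed Steiner system $\mathrm{MS}(t,k,\mathbb{Z}_2^n\times\mathbb{Z}_{r+1})$.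
   Context: A Steiner system $\mathrm{S}(t,k,n)$ is a collection of $k$-subsets (blocks) of an $n$-set such that each $t$-subset of the $n$-set is contained in exactly one block; Steiner systems on the same point set are disjoint if they have no block in common. The first $n$ coordinates of $\mathbb{Z}_2^n\times\mathbb{Z}_{r+1}$ are indexed by the points of $\mathbb{Z}_n$. For integers $q_1,\dots,q_N\ge 2$ let $Q=\mathbb{Z}_{q_1}\times\cdots\times\mathbb{Z}_{q_N}$, viewed as the set of words of length $N$ whose $i$-th letter lies in $\mathbb{Z}_{q_i}$. The weight of a word is its number of nonzero coordinates, and $d(\cdot,\cdot)$ is the Hamming distance. For integers $1\le t\le k\le N$, a mixed Steiner system $\mathrm{MS}(t,k,Q)$ is a set $\mathcal{C}$ of words of $Q$ of weight $k$ such that (i) for every word $x\in Q$ of weight $t$ there is exactly one $c\in\mathcal{C}$ with $d(x,c)=k-t$; and (ii) any two distinct elements of $\mathcal{C}$ are at Hamming distance at least $2(k-t)+1$. *)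

(* Defs.v *)
From mathcomp Require Import all_boot all_order all_algebra.

Set Implicit Arguments.
Unset Strict Implicit.
Unset Printing Implicit Defensive.

Definition covered (P : finType) (F : {set {set P}}) (S : {set P}) : bool :=
  [exists B in F, S \subset B].

(* S(t, k, #|P|) on the point set P *)
Definition steiner_system (P : finType) (t k : nat) (F : {set {set P}}) : Prop :=
  (forall B, B \in F -> #|B| = k) /\
  (forall S : {set P}, #|S| = t -> exists! B, B \in F /\ S \subset B).

Definition disjoint_systems (P : finType) (F G : {set {set P}}) : Prop :=
  [disjoint F & G].

(* Words over Z_(q 0) x ... x Z_(q N.-1). The type 'Z_m is the integers modulo
   m only for 1 < m, so this is the intended set when every q i is at least 2. *)
Definition word (N : nat) (q : 'I_N -> nat) : finType :=
  {dffun forall i : 'I_N, 'Z_(q i)}.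

Definition weight (N : nat) (q : 'I_N -> nat) (x : word q) : nat :=
  #|[set i | x i != 0%R]|.

Definition hamming (N : nat) (q : 'I_N -> nat) (x y : word q) : nat :=
  #|[set i | x i != y i]|.

(* MS(t, k, Q) for Q = word q; meant for 1 <= t <= k <= N and all q i >= 2
   (in particular k - t is not truncated). *)
Definition mixed_steiner_system (N : nat) (q : 'I_N -> nat) (t k : nat)
    (C : {set word q}) : Prop :=
  [/\ forall c, c \in C -> weight c = k,
      forall x : word q, weight x = t ->
        exists! c, c \in C /\ hamming x c = k - t
    & forall c c', c \in C -> c' \in C -> c != c' ->
        2 * (k - t) + 1 <= hamming c c'].

(* Z_2^n x Z_(r+1): coordinate lift ord_max j (of value j) is the binary
   coordinate of the point j : 'I_n, and ord_max is the last coordinate. *)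
Definition binary_tail_alphabet (n r : nat) (i : 'I_n.+1) : nat :=
  if i == ord_max then r.+1 else 2.
Arguments binary_tail_alphabet : clear implicits.

Definition block_word (n r : nat) (B : {set 'I_n}) (a : nat) :
    word (binary_tail_alphabet n r) :=
  [ffun i : 'I_n.+1 =>
     (if unlift ord_max i is Some j then (j \in B : nat)%:R else a%:R)%R
       : 'Z_(binary_tail_alphabet n r i)].

(* The systems are numbered from 0, so T i is tagged with the letter i + 1. *)
Definition tagged_code (n r : nat) (R : {set {set 'I_n}})
    (T : 'I_r -> {set {set 'I_n}}) : {set word (binary_tail_alphabet n r)} :=
  [set block_word r B 0 | B in R]
  :|: \bigcup_(i < r) [set block_word r B i.+1 | B in T i].

(* Main.v *)
(* A word is a pair (S, a) of a point set and a last letter, and the distance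
   between (A, a) and (B, b) is |A \ B| + |B \ A| + [a <> b].  A word of weight t
   is at distance k - t from a codeword exactly when the codeword extends it, so
   (i) says that each word (S, a) of weight t has a unique extension: the letter
   of the extension is determined by the covering hypotheses if a = 0 and equals
   a otherwise, and then the block is determined by R or by a Steiner system.
   The same uniqueness bounds the intersection of two distinct codewords: blocks
   with the same letter b share fewer than t - [b <> 0] points, blocks with
   different letters fewer than t points; this gives (ii). *)

Require Import Defs.
From mathcomp Require Import all_boot all_order all_algebra.
From mathcomp Require Import zify.

Set Implicit Arguments.
Unset Strict Implicit.
Unset Printing Implicit Defensive.

Lemma exists_subset_card (P : finType) (A : {set P}) (m : nat) :
  m <= #|A| -> exists2 S : {set P}, S \subset A & #|S| = m.
Proof.
rewrite -bin_gt0 -cards_draws => /card_gt0P [S].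
by rewrite inE => /andP [sSA /eqP cS]; exists S.
Qed.

Lemma card_set_ord_max (n : nat) (p : pred 'I_n.+1) :
  #|[set i | p i]| = #|[set j : 'I_n | p (lift ord_max j)]| + p ord_max.
Proof.
rewrite -!sum1dep_card big_mkcond (bigD1_ord ord_max) //= addnC.
by congr (_ + _); rewrite [RHS]big_mkcond.
Qed.

(** For [r = 0] the last alphabet would be ['Z_1], which has two elements; [0 < r] ensures that each
    ['Z_q] occurring here really has [q] letters. *)
Lemma alphabet_gt1 n r (i : 'I_n.+1) :
  0 < r -> 1 < binary_tail_alphabet n r i.
Proof. by rewrite /binary_tail_alphabet; case: ifP. Qed.

Lemma word_lt n r (r_gt0 : 0 < r) (x : word (binary_tail_alphabet n r)) i :
  x i < binary_tail_alphabet n r i.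
Proof.
exact: leq_trans (ltn_ord _) (eq_leq (Zp_cast (alphabet_gt1 i r_gt0))).
Qed.

Lemma block_word_lift n r (r_gt0 : 0 < r) (B : {set 'I_n}) a (j : 'I_n) :
  block_word r B a (lift ord_max j) = (j \in B) :> nat.
Proof.
rewrite ffunE liftK val_Zp_nat ?alphabet_gt1 // modn_small //.
by apply: leq_ltn_trans (leq_b1 _) _; apply: alphabet_gt1.
Qed.

Lemma block_word_max n r (r_gt0 : 0 < r) (B : {set 'I_n}) (a : 'I_r.+1) :
  block_word r B a ord_max = a :> nat.
Proof.
rewrite ffunE unlift_none val_Zp_nat ?alphabet_gt1 // modn_small //.
by rewrite /binary_tail_alphabet eqxx.
Qed.

Lemma weight_block_word n r (r_gt0 : 0 < r) (B : {set 'I_n}) (a : 'I_r.+1) :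
  weight (block_word r B a) = #|B| + (a != ord0).
Proof.
rewrite /weight card_set_ord_max; congr (_ + _).
  by apply: eq_card => j; rewrite inE -val_eqE /= block_word_lift; case: (j \in B).
by rewrite -val_eqE /= block_word_max.
Qed.

Lemma hamming_block_word n r (r_gt0 : 0 < r)
    (A B : {set 'I_n}) (a b : 'I_r.+1) :
  hamming (block_word r A a) (block_word r B b)
    = #|A :\: B| + #|B :\: A| + (a != b).
Proof.
rewrite /hamming card_set_ord_max -cardsUI; congr (_ + _); last first.
  by rewrite -val_eqE /= !block_word_max.
rewrite [X in _ + X](_ : _ = 0) ?addn0; last first.
  by apply/eqP; rewrite cards_eq0; apply/eqP/setP => j;
     rewrite !inE; case: (j \in A); case: (j \in B).
apply: eq_card => j; rewrite !inE -val_eqE /= !block_word_lift //.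
by case: (j \in A); case: (j \in B).
Qed.

Lemma block_word_surj n r (r_gt0 : 0 < r)
    (x : word (binary_tail_alphabet n r)) :
  exists S (a : 'I_r.+1), x = block_word r S a.
Proof.
exists [set j | x (lift ord_max j) != 0%R], (inord (x ord_max)).
apply/ffunP => i; apply: val_inj => /=.
case: (unliftP ord_max i) => [j|] ->.
  rewrite (block_word_lift r_gt0) inE -val_eqE /=.
  (* A nonzero binary letter must be 1, so the support determines the binary part of the word. *)
  have: x (lift ord_max j) < 2.
    apply: leq_trans (word_lt r_gt0 x _) _.
    by rewrite /binary_tail_alphabet eq_sym (negPf (neq_lift _ _)).
  by case: (nat_of_ord (x _)) => [|[]].
rewrite (block_word_max r_gt0) inordK //.
apply: leq_trans (word_lt r_gt0 x _) _.
by rewrite /binary_tail_alphabet eqxx.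
Qed.

Definition extended_by n r (S : {set 'I_n}) (a : 'I_r.+1) (B : {set 'I_n})
    (b : 'I_r.+1) : bool :=
  (S \subset B) && ((a == ord0) || (a == b)).

(** Over the integers the distance is [k - t] plus [2 * #|S :\: B|] plus
    [(a != 0) - (b != 0) + (a != b)]. Both added terms are nonnegative, and the second vanishes
    exactly when [a] is 0 or [b]. *)
Lemma hamming_extended_by n r (r_gt0 : 0 < r) t k
    (S : {set 'I_n}) (a : 'I_r.+1) (B : {set 'I_n}) (b : 'I_r.+1) :
    #|S| + (a != ord0) = t -> #|B| + (b != ord0) = k -> t <= k ->
  hamming (block_word r S a) (block_word r B b) = k - t <-> extended_by S a B b.
Proof.
move=> cS cB le_tk; rewrite hamming_block_word // /extended_by.
rewrite -setD_eq0 -cards_eq0.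
have := cardsID B S; have := cardsID S B; rewrite [B :&: S]setIC.
(* These two implications exclude the inconsistent combinations of the three equality tests in the
   case analysis. *)
have : (a == ord0) -> (b == ord0) = (a == b) by move=> /eqP ->; rewrite eq_sym.
have : (a == b) -> (a == ord0) = (b == ord0) by move=> /eqP ->.
move: cS cB; case: (a == ord0); case: (b == ord0); case: (a == b) => /=; lia.
Qed.

(** Indexing all blocks by their letter lets both kinds of codewords be treated alike. *)
Definition letter_blocks n r
    (R : {set {set 'I_n}}) (T : 'I_r -> {set {set 'I_n}})
    (a : 'I_r.+1) : {set {set 'I_n}} :=
  if unlift ord0 a is Some i then T i else R.

Lemma tagged_codeP n r (R : {set {set 'I_n}}) (T : 'I_r -> {set {set 'I_n}})
    (c : word (binary_tail_alphabet n r)) :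
  reflect (exists (a : 'I_r.+1) B,
             B \in letter_blocks R T a /\ c = block_word r B a)
          (c \in tagged_code R T).
Proof.
apply: (iffP setUP) => [[/imsetP [B BR ->]|/bigcupP [i _ /imsetP [B BT ->]]]|].
- by exists ord0, B; rewrite /letter_blocks unlift_none.
- by exists (lift ord0 i), B; rewrite /letter_blocks liftK.
case=> a [B [+ ->]]; rewrite /letter_blocks.
case: (unliftP ord0 a) => [i|] -> BT; last by left; apply: imset_f.
by right; apply/bigcupP; exists i => //; apply: imset_f.
Qed.

Theorem theorem16 (n k t r : nat)
    (R : {set {set 'I_n}}) (T : 'I_r -> {set {set 'I_n}})
    (hn : 0 < n) (hk : 0 < k) (ht : 0 < t) (hr : 0 < r) (htk : t <= k)
    (hRk : forall A, A \in R -> #|A| = k)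
    (hRt : forall S : {set 'I_n}, #|S| = t ->
       #|[set A in R | S \subset A]| <= 1)
    (hT : forall i, steiner_system (t - 1) (k - 1) (T i))
    (hTdisj : forall i j, i != j -> disjoint_systems (T i) (T j))
    (hTcov : forall S : {set 'I_n}, #|S| = t -> ~~ covered R S ->
       exists! i, covered (T i) S)
    (hTncov : forall S : {set 'I_n}, #|S| = t -> covered R S ->
       forall i, ~~ covered (T i) S) :
  mixed_steiner_system t k (tagged_code R T).
Proof.
have coveredI (F : {set {set 'I_n}}) (S B : {set 'I_n}) :
    B \in F -> S \subset B -> covered F S.
  by move=> BF sSB; apply/exists_inP; exists B.
have card_block (a : 'I_r.+1) B :
    B \in letter_blocks R T a -> #|B| + (a != ord0) = k.
  rewrite /letter_blocks; case: unliftP => [i|] -> BL.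
    by rewrite (proj1 (hT i) _ BL) -(inj_eq val_inj) /= addn1 subn1 prednK.
  by rewrite eqxx addn0 hRk.
have letter_uniq (S B B' : {set 'I_n}) (b b' : 'I_r.+1) :
    t <= #|S| -> B \in letter_blocks R T b -> B' \in letter_blocks R T b' ->
    S \subset B -> S \subset B' -> b = b'.
  (* The covering hypotheses concern exactly [t] points, so [S] is first cut down to a
     [t]-subset. *)
  move=> /exists_subset_card [S' sS'S cS'] BL BL' sSB sSB'.
  have {sSB}sB := subset_trans sS'S sSB; have {sSB'}sB' := subset_trans sS'S sSB'.
  move: BL BL'; rewrite /letter_blocks.
  case: (unliftP ord0 b) (unliftP ord0 b') => [i|] -> [j|] -> // BL BL'.
  - have cR : ~~ covered R S'.
      by apply/negP => /(hTncov _ cS') /(_ i); rewrite (coveredI _ _ _ BL sB).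
    have [l [_ ul]] := hTcov _ cS' cR.
    by rewrite -(ul i (coveredI _ _ _ BL sB)) -(ul j (coveredI _ _ _ BL' sB')).
  - by have := hTncov _ cS' (coveredI _ _ _ BL' sB') i; rewrite (coveredI _ _ _ BL sB).
  - by have := hTncov _ cS' (coveredI _ _ _ BL sB) j; rewrite (coveredI _ _ _ BL' sB').
have block_uniq (S B B' : {set 'I_n}) (b : 'I_r.+1) :
    t <= #|S| + (b != ord0) ->
    B \in letter_blocks R T b -> B' \in letter_blocks R T b ->
    S \subset B -> S \subset B' -> B = B'.
  rewrite /letter_blocks; case: unliftP => [i|] ->.
    (* A nonzero letter accounts for one unit of weight, leaving the [t - 1] points on which a
       Steiner system determines its block. *)
    rewrite addn1 => tS.
    have /exists_subset_card [S' sS'S cS'] : t - 1 <= #|S| by lia.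
    move=> BL BL' sSB sSB'; have [D [_ uD]] := proj2 (hT i) _ cS'.
    have DB : D = B by apply: uD; split=> //; apply: subset_trans sS'S _.
    by rewrite -DB; apply: uD; split=> //; apply: subset_trans sS'S _.
  rewrite eqxx addn0 => /exists_subset_card [S' sS'S cS'] BL BL' sSB sSB'.
  apply: (card_le1_eqP (hRt _ cS')); rewrite inE ?BL ?BL' /=;
    exact: subset_trans sS'S _.
split.
- move=> c /tagged_codeP [a [B [BL ->]]].
  by rewrite weight_block_word ?card_block.
- move=> x; have [S [a ->]] := block_word_surj hr x.
  rewrite weight_block_word // => cS.
  have [b [B [BL eB]]] : exists (b : 'I_r.+1) B,
      B \in letter_blocks R T b /\ extended_by S a B b.
    rewrite /extended_by; case: (unliftP ord0 a) cS => [i|] ->.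
      rewrite -(inj_eq val_inj) /= => cS.
      have /(proj2 (hT i)) [B [[BT sSB] _]] : #|S| = t - 1 by rewrite -cS addnK.
      by exists (lift ord0 i), B; rewrite /letter_blocks liftK sSB eqxx.
    (* A zero last letter is kept if [R] covers [S]; otherwise it becomes the letter of the system
       covering [S]. *)
    rewrite eqxx addn0 => cS; have [cR|ncR] := boolP (covered R S).
      have /exists_inP [B BR sSB] := cR.
      by exists ord0, B; rewrite /letter_blocks unlift_none sSB.
    have [i [/exists_inP [B BT sSB] _]] := hTcov _ cS ncR.
    by exists (lift ord0 i), B; rewrite /letter_blocks liftK sSB.
  exists (block_word r B b); split.
    split; first by apply/tagged_codeP; exists b, B.
    exact/(hamming_extended_by hr cS (card_block _ _ BL) htk).
  move=> _ [/tagged_codeP [b' [B' [BL' ->]]]].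
  move/(hamming_extended_by hr cS (card_block _ _ BL') htk).
  move: eB => /andP [sSB ab] /andP [sSB' ab'].
  have bb' : b = b'.
    have [a0|a0] := eqVneq a ord0.
      by apply: (letter_uniq S B B') => //; rewrite -cS a0 eqxx addn0.
    by move: ab ab'; rewrite (negPf a0) /= => /eqP <- /eqP <-.
  rewrite -bb' in BL' *; congr (block_word r _ b).
  (* It remains to see that [b] is nonzero whenever [a] is, which holds because then [b = a]. *)
  apply: (block_uniq S _ _ b) => //; rewrite -cS leq_add2l.
  have [//|na0] := eqVneq a ord0.
  by move: ab; rewrite (negPf na0) /= => /eqP <-; rewrite na0.
- move=> _ _ /tagged_codeP [b [B [BL ->]]] /tagged_codeP [b' [B' [BL' ->]]] neq.
  have cB := card_block _ _ BL; have cB' := card_block _ _ BL'.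
  have ltLetters : b != b' -> #|B :&: B'| < t.
    rewrite ltnNge; apply: contra => le_tI; apply/eqP.
    exact: letter_uniq le_tI BL BL' (subsetIl _ _) (subsetIr _ _).
  have ltBlocks : b = b' -> #|B :&: B'| + (b != ord0) < t.
    move=> bb'; rewrite -bb' in BL' neq; rewrite ltnNge; apply: contra neq.
    move=> /block_uniq /(_ BL BL' (subsetIl _ _) (subsetIr _ _)) ->.
    exact: eqxx.
  rewrite hamming_block_word //.
  have := cardsID B B'; have := cardsID B' B; rewrite [B' :&: B]setIC.
  have [bb'|nbb'] := eqVneq b b'.
    (* The letter's contributions to block size and intersection bound cancel, giving distance at
       least [2 * (k - t) + 2]. *)
    by move: cB cB' (ltBlocks bb'); rewrite -bb'; case: (b != ord0) => /=; lia.
  have : (b != ord0) || (b' != ord0).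
    by rewrite -negb_and; apply: contra nbb' => /andP [/eqP -> /eqP ->].
  (* The bound is weakest when both letters are nonzero: [2 * (k - 1) - 2 * (t - 1)] from the
     points, plus 1 from the differing letters. *)
  move: cB cB' (ltLetters nbb').
  by case: (b != ord0); case: (b' != ord0) => //=; lia.
Qed.
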